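(* Let $\mathbf{A}$ be a small concrete category. (A) For the cometic functor $F_{\mathrm{com}}\colon\mathbf{A}\to\mathbf{Set}$ and the cometic projection $\boldsymbol{\pi}^{\mathrm{com}}$ associated with $\mathbf{A}$, the following hold. (i) $F_{\mathrm{com}}\colon\mathbf{A}\to\mathbf{Set}$ is a totally faithful functor, and $\boldsymbol{\pi}^{\mathrm{com}}\colon F_{\mathrm{com}}\to I_{\mathbf{A},\mathbf{Set}}$ is a natural transformation whose components are surjective maps, where $I_{\mathbf{A},\mathbf{Set}}$ denotes the inclusion functor of $\mathbf{A}$ into $\mathbf{Set}$. (ii) For every $f\in\mathrm{Mor}(\mathbf{A})$, $f$ is a monomorphism in $\mathbf{A}$ if and only if $F_{\mathrm{com}}(f)$ is an injective map. (B) Whenever $F\colon\mathbf{A}\to\mathbf{Set}$ is a functor and $\boldsymbol{\kappa}\colon F\to I_{\mathbf{A},\mathbf{Set}}$ is a natural transformation whose components are surjective maps, then for every morphism $f\in\mathrm{Mor}(\mathbf{A})$, if $F(f)$ is an injective map, then $f$ is a monomorphism in $\mathbf{A}$.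
   Context: Conventions on categories. For a category $\mathbf{A}$, $\mathrm{Ob}(\mathbf{A})$ and $\mathrm{Mor}(\mathbf{A})$ are its classes of objects and morphisms; $\mathrm{Mor}(X,Y)=\mathrm{Mor}_{\mathbf{A}}(X,Y)$ is the set of morphisms with source $X$ and target $Y$, and $\mathrm{Mor}(\mathbf{A})$ is the disjoint union of these hom-sets (so every morphism determines its source and its target). $\mathbf{A}$ is small if $\mathrm{Ob}(\mathbf{A})$ is a set. A category $\mathbf{A}$ is a concrete category if every object of $\mathbf{A}$ is a set, every $f\in\mathrm{Mor}(X,Y)$ is a map from $X$ to $Y$, and the operation is the usual composition of maps, $(f\circ g)(x)=f(g(x))$. (Not every map $X\to Y$ has to be a morphism.) $\mathbf{Set}$ is the category of all sets with all maps between sets. The inclusion functor $I_{\mathbf{A},\mathbf{Set}}\colon\mathbf{A}\to\mathbf{Set}$ is given by $X\mapsto X$ on objects and $f\mapsto f$ on morphisms. A morphism $f$ is a monomorphism in $\mathbf{A}$ if $f\circ g_1=f\circ g_2$ implies $g_1=g_2$ for all $g_1,g_2\in\mathrm{Mor}(\mathbf{A})$ for which both composites are defined. A functor $F\colon\mathbf{A}\to\mathbf{B}$ is totally faithful if for all $f,g\in\mathrm{Mor}(\mathbf{A})$ (not necessarily in the same hom-set), $f\neq g$ implies $F(f)\neq F(g)$. Cometic functor. Let $\mathbf{A}$ be a small concrete category. An eligible triplet of $\mathbf{A}$ is a triplet $\langle f,x,y\rangle$ such that there exist $X,Y\in\mathrm{Ob}(\mathbf{A})$ with $f\in\mathrm{Mor}_{\mathbf{A}}(X,Y)$,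 $x\in X$, $y\in Y$, and $f(x)=y$. The cometic functor $F_{\mathrm{com}}\colon\mathbf{A}\to\mathbf{Set}$ associated with $\mathbf{A}$ is defined as follows. For $Y\in\mathrm{Ob}(\mathbf{A})$, $$F_{\mathrm{com}}(Y)=\{\langle f,x,y\rangle : \text{there is } X\in\mathrm{Ob}(\mathbf{A}) \text{ with } f\in\mathrm{Mor}_{\mathbf{A}}(X,Y),\ x\in X,\ y=f(x)\in Y\}.$$ For $g\in\mathrm{Mor}_{\mathbf{A}}(X,Y)$, the map $F_{\mathrm{com}}(g)\colon F_{\mathrm{com}}(X)\to F_{\mathrm{com}}(Y)$ is defined by $\langle f,x,y\rangle\mapsto\langle g\circ f,x,g(y)\rangle$. Cometic projection. The cometic projection $\boldsymbol{\pi}^{\mathrm{com}}$ associated with $\mathbf{A}$ is the transformation from $F_{\mathrm{com}}$ to $I_{\mathbf{A},\mathbf{Set}}$ whose component at $X\in\mathrm{Ob}(\mathbf{A})$ is the map $\boldsymbol{\pi}^{\mathrm{com}}_X\colon F_{\mathrm{com}}(X)\to X$, $\langle f,x,y\rangle\mapsto y$. *)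

(* Defs.v *)
From mathcomp Require Import all_boot.
From mathcomp Require Import boolp classical_sets functions.

Set Implicit Arguments.
Unset Strict Implicit.
Unset Printing Implicit Defensive.

Local Open Scope classical_set_scope.

Record category := Category {
  Ob :> Type;
  Hom : Ob -> Ob -> Type;
  idm : forall X, Hom X X;
  compm : forall X Y Z, Hom Y Z -> Hom X Y -> Hom X Z;
  compm_idl : forall X Y (f : Hom X Y), compm (idm Y) f = f;
  compm_idr : forall X Y (f : Hom X Y), compm f (idm X) = f;
  compm_assoc : forall W X Y Z (f : Hom Y Z) (g : Hom X Y) (h : Hom W X),
    compm f (compm g h) = compm (compm f g) h }.

Arguments Hom {c} X Y.
Arguments idm {c} X.
Arguments compm {c X Y Z} f g.

(* The disjoint union of the hom-sets: an equality of two elements includes the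
   equality of their sources and of their targets. The parameter is a family of
   hom-sets rather than a category so that the universe of [mor H] follows that
   of [H]: the morphisms of a small category must be able to form a set. *)
Record mor (O : Type) (H : O -> O -> Type) := Mor {
  src : O;
  tgt : O;
  arr : H src tgt }.

Arguments Mor {O H src tgt} arr.

Definition monomorphism (A : category) (X Y : A) (f : Hom X Y) : Prop :=
  forall (W1 W2 : A) (g1 : Hom W1 X) (g2 : Hom W2 X),
    Mor (compm f g1) = Mor (compm f g2) -> Mor g1 = Mor g2.

Record functor_data (A B : category) := FunctorData {
  fob :> A -> B;
  fhom : forall X Y : A, Hom X Y -> Hom (fob X) (fob Y) }.

Arguments FunctorData {A B fob} fhom.
Arguments fhom {A B} F {X Y} f : rename.

Definition is_functor (A B : category) (F : functor_data A B) : Prop :=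
  (forall X : A, fhom F (idm X) = idm (F X)) /\
  (forall (X Y Z : A) (f : Hom Y Z) (g : Hom X Y),
     fhom F (compm f g) = compm (fhom F f) (fhom F g)).

Definition totally_faithful (A B : category) (F : functor_data A B) : Prop :=
  forall f g : mor (@Hom A), f <> g -> Mor (fhom F (arr f)) <> Mor (fhom F (arr g)).

Definition transformation (A B : category) (F G : functor_data A B) : Type :=
  forall X : A, Hom (F X) (G X).

Definition natural (A B : category) (F G : functor_data A B)
    (k : transformation F G) : Prop :=
  forall (X Y : A) (f : Hom X Y),
    compm (k Y) (fhom F f) = compm (fhom G f) (k X).

(* A set is a subset of some ambient type, so that two sets with the same
   ambient type are equal exactly when they have the same elements; for bare
   types, an inequality such as the one in [totally_faithful] would not be
   meaningful. *)
Record set_object := SetObject {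
  ambient : Type;
  elements : set ambient }.

Arguments elements : clear implicits.

Definition SET : category := {|
  Ob := set_object;
  Hom := fun X Y => elements X -> elements Y;
  idm := fun X => id;
  compm := fun X Y Z f g => f \o g;
  compm_idl := fun X Y f => erefl;
  compm_idr := fun X Y f => erefl;
  compm_assoc := fun W X Y Z f g h => erefl |}.

(* Since the objects form a set, they are all subsets of one set, their union;
   [point] is the type of its elements. The objects may overlap. *)
Record small_concrete_category := SmallConcreteCategory {
  point : Type;
  objects : set (set point);
  maps : forall X Y : objects, set (\val X -> \val Y);
  maps_id : forall X : objects, @maps X X id;
  maps_comp : forall (X Y Z : objects) (f : \val Y -> \val Z)
    (g : \val X -> \val Y), @maps Y Z f -> @maps X Y g -> @maps X Z (f \o g) }.

Arguments objects : clear implicits.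
Arguments maps {s} X Y.

Section Concrete.
Variable A : small_concrete_category.

Definition arrow (X Y : objects A) : Type := maps X Y.

Definition concrete_id (X : objects A) : arrow X X :=
  exist _ id (mem_set (maps_id X)).

Definition concrete_comp (X Y Z : objects A) (f : arrow Y Z) (g : arrow X Y) :
    arrow X Z :=
  exist _ (\val f \o \val g)
    (mem_set (maps_comp (set_mem (valP f)) (set_mem (valP g)))).

Lemma concrete_idl (X Y : objects A) (f : arrow X Y) :
  concrete_comp (concrete_id Y) f = f.
Proof. exact: val_inj. Qed.

Lemma concrete_idr (X Y : objects A) (f : arrow X Y) :
  concrete_comp f (concrete_id X) = f.
Proof. exact: val_inj. Qed.

Lemma concrete_assoc (W X Y Z : objects A) (f : arrow Y Z) (g : arrow X Y)
    (h : arrow W X) :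
  concrete_comp f (concrete_comp g h) = concrete_comp (concrete_comp f g) h.
Proof. exact: val_inj. Qed.

Definition concrete_category : category := {|
  Ob := objects A;
  Hom := arrow;
  idm := concrete_id;
  compm := concrete_comp;
  compm_idl := concrete_idl;
  compm_idr := concrete_idr;
  compm_assoc := concrete_assoc |}.

End Concrete.

Coercion concrete_category : small_concrete_category >-> category.

Definition inclusion (A : small_concrete_category) : functor_data A SET :=
  @FunctorData A SET (fun X => SetObject (\val X)) (fun X Y f => \val f).

Lemma inclusion_functor (A : small_concrete_category) :
  is_functor (inclusion A).
Proof. by []. Qed.

Record triplet (A : small_concrete_category) := Triplet {
  tmor : mor (@arrow A);
  tfst : point A;
  tsnd : point A }.

Section Cometic.
Variable A : small_concrete_category.

Definition com_set (Y : objects A) : set (triplet A) :=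
  [set t | exists (X : objects A) (f : arrow X Y) (x : \val X),
     t = Triplet (Mor f) (\val x) (\val (\val f x))].

Lemma com_set_tgt (Y : objects A) (t : com_set Y) : tgt (tmor (\val t)) = Y.
Proof. by have [X [f [x ->]]] := set_mem (valP t). Qed.

Lemma com_set_snd (Y : objects A) (t : com_set Y) : tsnd (\val t) \in \val Y.
Proof. by have [X [f [x ->]]] := set_mem (valP t); exact: valP. Qed.

Definition com_proj (Y : objects A) (t : com_set Y) : \val Y :=
  exist _ (tsnd (\val t)) (com_set_snd t).

(* The first entry of a triplet in [com_set Y], typed with target [Y]. *)
Definition com_hom (Y : objects A) (t : com_set Y) :
    arrow (src (tmor (\val t))) Y :=
  eq_rect _ (arrow (src (tmor (\val t)))) (arr (tmor (\val t))) _
    (com_set_tgt t).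

Definition com_triplet (X Y : objects A) (g : arrow X Y) (t : com_set X) :
    triplet A :=
  Triplet (Mor (concrete_comp g (com_hom t))) (tfst (\val t))
    (\val (\val g (com_proj t))).

Lemma com_tripletE (W X Y : objects A) (g : arrow X Y) (f : arrow W X)
    (x : \val W) (t : com_set X) :
  \val t = Triplet (Mor f) (\val x) (\val (\val f x)) ->
  com_triplet g t =
    Triplet (Mor (concrete_comp g f)) (\val x) (\val (\val g (\val f x))).
Proof.
case: t => t tX /= tE; rewrite /com_triplet.
have -> : com_proj (exist _ t tX) = \val f x by apply: val_inj; rewrite /= tE.
rewrite /com_hom; move: (com_set_tgt _); rewrite /= tE /= => e.
by rewrite (Prop_irrelevance e erefl).
Qed.

Lemma com_triplet_in (X Y : objects A) (g : arrow X Y) (t : com_set X) :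
  com_triplet g t \in com_set Y.
Proof.
have [W [f [x tE]]] := set_mem (valP t).
by apply/mem_set; exists W, (concrete_comp g f), x; exact: com_tripletE.
Qed.

Definition cometic : functor_data A SET :=
  @FunctorData A SET (fun Y => SetObject (com_set Y))
    (fun X Y g t => exist _ (com_triplet g t) (com_triplet_in g t)).

Definition cometic_proj : transformation cometic (inclusion A) :=
  com_proj.

End Cometic.

Arguments cometic_proj : clear implicits.

Definition surjective_map (X Y : SET) (f : Hom X Y) : Prop :=
  set_surj [set: elements X] [set: elements Y] f.

Definition injective_map (X Y : SET) (f : Hom X Y) : Prop := injective f.

(* Main.v *)
Require Import Defs.
From mathcomp Require Import all_boot.
From mathcomp Require Import boolp classical_sets functions.

Set Implicit Arguments.
Unset Strict Implicit.
Unset Printing Implicit Defensive.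

Local Open Scope classical_set_scope.

(** The elements of the cometic set of [Y] are the pairs of an arrow [f] with
    target [Y] and a point [x] of its source, because the third entry of a
    triplet is [f x]. In this description, [com_elt f x], the cometic functor
    is post-composition, [com_elt f x |-> com_elt (g \o f) x], and the cometic
    projection is evaluation, [com_elt f x |-> f x] ([cometicE],
    [cometic_projE]). Functoriality and naturality are then associativity and
    the definition of composition, and the projection at [X] is surjective
    because [x] is the value of [com_elt id x].

    Total faithfulness: the element [com_elt id x] remembers [X], as the target
    of its first entry, and is sent by [g] to [com_elt g x], which remembers
    [g]. A nonempty object is thus recovered from its cometic set, and an arrow
    with nonempty source from its image. The cometic set of an empty object is
    empty, but the empty set is a single object, with at most one arrow to any
    given object.

    Monomorphisms: if [f] is one, then [com_elt (f \o h) x] determines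
    [f \o h] and [x], hence [h] and [x]. The converse is an instance of (B). For
    (B), a natural surjection [k] lets one test the equality of two arrows
    [g1], [g2] on the points [k s], where [g_i (k s) = k (F g_i s)]; if
    [f \o g1 = f \o g2] and [F f] is injective, then [F g1 = F g2]. *)

(** A morphism of the disjoint union with prescribed ends determines its arrow:
    this is uniqueness of equality proofs between the ends. *)
Lemma Mor_inj (O : Type) (H : O -> O -> Type) (X Y : O) (f g : H X Y) :
  Mor f = Mor g -> f = g.
Proof.
pose P (m : mor H) := forall (e1 : src m = X) (e2 : tgt m = Y),
  eq_rect _ (H X) (eq_rect _ (fun s => H s (tgt m)) (arr m) _ e1) _ e2 = f.
move=> fg; have : P (Mor f).
  by move=> e1 e2; rewrite (Prop_irrelevance e1 erefl) (Prop_irrelevance e2 erefl).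
by rewrite fg => /(_ erefl erefl) /= ->.
Qed.

Lemma SetObject_inj (T : Type) (S S' : set T) :
  SetObject S = SetObject S' -> S = S'.
Proof.
pose P (Z : set_object) := forall e : ambient Z = T,
  eq_rect _ (fun U => set U) (elements Z) _ e = S.
move=> SS'; have : P (SetObject S).
  by move=> e; rewrite (Prop_irrelevance e erefl).
by rewrite SS' => /(_ erefl) /= ->.
Qed.

Section CometicElements.
Variable A : small_concrete_category.
Implicit Types W X Y Z : objects A.

Lemma arrow_ext X Y (f g : arrow X Y) :
  (forall x, \val f x = \val g x) -> f = g.
Proof. by move=> fg; apply: val_inj; apply: funext. Qed.

Lemma com_elt_in X Y (f : arrow X Y) (x : \val X) :
  Triplet (Mor f) (\val x) (\val (\val f x)) \in com_set Y.
Proof. by apply/mem_set; exists X, f, x. Qed.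

Definition com_elt X Y (f : arrow X Y) (x : \val X) : com_set Y :=
  exist (fun t => t \in com_set Y) _ (com_elt_in f x).

Lemma com_eltP Y (t : com_set Y) :
  exists X (f : arrow X Y) (x : \val X), t = com_elt f x.
Proof.
have [X [f [x tE]]] := set_mem (valP t).
by exists X, f, x; apply: val_inj.
Qed.

Lemma com_elt_inj X X' Y (f : arrow X Y) (f' : arrow X' Y)
    (x : \val X) (x' : \val X') :
  com_elt f x = com_elt f' x' -> Mor f = Mor f' /\ \val x = \val x'.
Proof.
move=> /(congr1 (fun t : com_set Y => \val t)) /= e; split.
  exact: (congr1 (@tmor A) e).
exact: (congr1 (@tfst A) e).
Qed.

Lemma eq_com_elt X X' Y (f : arrow X Y) (f' : arrow X' Y)
    (x : \val X) (x' : \val X') :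
  Mor f = Mor f' -> \val x = \val x' -> com_elt f x = com_elt f' x'.
Proof.
move=> ff'; have XX' : X = X' := congr1 (@src _ _) ff'.
subst X'; have <- := Mor_inj ff'; move=> xx'.
by rewrite (val_inj xx').
Qed.

Lemma cometicE X Y Z (g : arrow Y Z) (f : arrow X Y) (x : \val X) :
  fhom (cometic A) g (com_elt f x) = com_elt (concrete_comp g f) x.
Proof. by apply: val_inj; exact: com_tripletE. Qed.

Lemma cometic_projE X Y (f : arrow X Y) (x : \val X) :
  cometic_proj A Y (com_elt f x) = \val f x.
Proof. exact: val_inj. Qed.

(** A point [x] of [X] puts [com_elt id x] in both cometic sets, and the target
    of its first entry is then both [X] and [X']. *)
Lemma com_set_inhabited_inj X X' (x : \val X) : com_set X = com_set X' -> X = X'.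
Proof.
move=> XX'; have := com_elt_in (concrete_id X) x.
by rewrite XX' => /set_mem [W [f [y /(congr1 (@tmor A)) /(congr1 (@tgt _ _))]]].
Qed.

(** When neither object has a point, both are the empty set, which is one
    object because the objects form a set of sets. *)
Lemma com_set_inj X X' : com_set X = com_set X' -> X = X'.
Proof.
move=> XX'.
have [[x]|nX] := pselect (inhabited (\val X)).
  exact: com_set_inhabited_inj x XX'.
have [[x]|nX'] := pselect (inhabited (\val X')).
  by apply/esym/(com_set_inhabited_inj x).
have empty (Z : objects A) : ~ inhabited (\val Z) -> \val Z = set0.
  move=> nZ; apply/seteqP; split=> // z Zz.
  by apply: nZ; constructor; exact: (exist _ z (mem_set Zz)).
by apply: val_inj; rewrite (empty _ nX) (empty _ nX').
Qed.

Lemma cometic_functor : is_functor (cometic A).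
Proof.
split=> [X|X Y Z f g]; apply: funext => t; have [W [h [x ->]]] := com_eltP t.
  by rewrite cometicE concrete_idl.
rewrite -[RHS]/(fhom (cometic A) f (fhom (cometic A) g (com_elt h x))).
by rewrite !cometicE concrete_assoc.
Qed.

Lemma cometic_totally_faithful : totally_faithful (cometic A).
Proof.
move=> [X Y f] [X' Y' g] fg /= FfFg; apply: fg.
have XX' : X = X' := com_set_inj (SetObject_inj (congr1 (@src _ _) FfFg)).
have YY' : Y = Y' := com_set_inj (SetObject_inj (congr1 (@tgt _ _) FfFg)).
subst X' Y'.
have {FfFg} FfFg : fhom (cometic A) f = fhom (cometic A) g := Mor_inj FfFg.
congr Mor; apply: arrow_ext => x.
(* [F f] sends [com_elt id x] to [com_elt f x], whose first entry is [f]. *)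
have : fhom (cometic A) f (com_elt (concrete_id X) x) =
  fhom (cometic A) g (com_elt (concrete_id X) x) by rewrite FfFg.
by rewrite !cometicE !concrete_idr => /com_elt_inj [/(Mor_inj (H := @arrow A)) -> _].
Qed.

Lemma cometic_proj_natural : natural (cometic_proj A).
Proof.
move=> X Y g; apply: funext => t; have [W [h [x ->]]] := com_eltP t.
rewrite -[LHS]/(cometic_proj A Y (fhom (cometic A) g (com_elt h x))).
rewrite -[RHS]/(\val g (cometic_proj A X (com_elt h x))).
by rewrite cometicE !cometic_projE.
Qed.

Lemma cometic_proj_surjective X : surjective_map (cometic_proj A X).
Proof.
move=> x _; exists (com_elt (concrete_id X) x) => //.
by rewrite cometic_projE.
Qed.

Lemma cometic_monomorphism_injective (X Y : A) (f : Hom X Y) :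
  monomorphism f -> injective_map (fhom (cometic A) f).
Proof.
move=> monof t1 t2.
have [W1 [h1 [x1 ->]]] := com_eltP t1; have [W2 [h2 [x2 ->]]] := com_eltP t2.
rewrite !cometicE => /com_elt_inj [fh xx].
by apply: eq_com_elt => //; exact: (monof _ _ h1 h2).
Qed.

(** Every point of the common source of [g1] and [g2] has the form [k W s], so
    naturality reduces [g1 = g2] to [F g1 s = F g2 s], which can be checked
    after applying [F f]. *)
Lemma injective_monomorphism (F : functor_data A SET)
    (k : transformation F (inclusion A)) :
  is_functor F -> natural k -> (forall X : A, surjective_map (k X)) ->
  forall (X Y : A) (f : Hom X Y), injective_map (fhom F f) -> monomorphism f.
Proof.
move=> [_ FM] natk surjk X Y f injFf W W' g1 g2 fg.
have WW' : W = W' := congr1 (@src _ _) fg.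
subst W'; have {fg} fg := Mor_inj fg.
congr Mor; apply: arrow_ext => w.
have [s _ <-] := surjk W w I.
have kg (g : Hom W X) : \val g (k W s) = k X (fhom F g s).
  exact: (congr1 (fun u => u s) (esym (natk _ _ g))).
rewrite !kg; congr (k X _); apply: injFf.
have := congr1 (fun h => fhom F h s) fg.
by rewrite !FM.
Qed.

End CometicElements.

Theorem theorem3p6 (A : small_concrete_category) :
  ((is_functor (cometic A) /\ totally_faithful (cometic A) /\
    natural (cometic_proj A) /\
    (forall X : A, surjective_map (cometic_proj A X))) /\
   (forall (X Y : A) (f : Hom X Y),
      monomorphism f <-> injective_map (fhom (cometic A) f))) /\
  (forall (F : functor_data A SET) (k : transformation F (inclusion A)),
     is_functor F -> natural k ->
     (forall X : A, surjective_map (k X)) ->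
     forall (X Y : A) (f : Hom X Y),
       injective_map (fhom F f) -> monomorphism f).
Proof.
have FA := @cometic_functor A; have natA := @cometic_proj_natural A.
have surjA := @cometic_proj_surjective A.
split; last exact: injective_monomorphism.
split.
  by split=> //; split; [exact: cometic_totally_faithful | split].
move=> X Y f; split; first exact: cometic_monomorphism_injective.
exact: (injective_monomorphism FA natA surjA).
Qed.
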